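(* Let $G$ be a finite group and let $C_i=g_iH_i$ ($i=1,\ldots,n$) be left cosets of subgroups $H_i\le G$, with $g_i\in G$, such that $A:=G\setminus(C_1\cup\ldots\cup C_n)\neq\varnothing$. Let $K:=H_1\cap\ldots\cap H_n$. Then $$|A|=\frac{|G|}{2^n}\quad\Longleftrightarrow\quad A=aK\ \text{for some }a\in G\ \text{and}\ |G:K|=2^n.$$ Moreover, if these equivalent conditions hold, then the subgroups $H_1,\ldots,H_n$ are pairwise distinct.
   Context: $|G:K|$ denotes the index of the subgroup $K$ in $G$. $n$ is a positive integer. *)

(* Defs.v *)
From mathcomp Require Import all_boot all_order all_fingroup all_algebra.

(* Main.v *)
Require Import Defs.
From mathcomp Require Import all_boot all_order all_fingroup all_algebra.

(**
  Label the left cosets of each [H i] by distinct rationals, write [phi i x] for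
  the label of [x *: H i], and consider the matrix
  [M y x = \prod_i (phi i x - phi i (y * g i))] for [x, y] in [G].  Its entry at
  [(y, x)] is nonzero exactly when [y^-1 * x] is in [A], so each row has [#|A|]
  nonzero entries, and no column vanishes.  Expanding the product shows that
  [M = V *m U], where row [S] of [U] is [x |-> \prod_(i in S) phi i x]; in
  particular [M] has rank at most [2 ^ n].  The supports of a row basis of [M]
  cover all columns, so if [#|G| = 2 ^ n * #|A|] then the rank is [2 ^ n] and
  these supports are pairwise disjoint.  The row basis of [M] is then also a row
  basis of [U], hence the columns of [U] indexed by the support of one basis row
  are parallel.  Comparing the rows of [U] given by the empty set and by
  singletons, [phi i] is constant on a translate of [A], so [A] lies in a single
  coset of the intersection of the [H i].  As the rows of [U] are independent, so
  are the [phi i], and the [H i] are distinct.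
*)

Set Implicit Arguments.
Unset Strict Implicit.
Unset Printing Implicit Defensive.

Import GroupScope GRing.Theory.
Local Open Scope ring_scope.

Lemma sparse_mulmx (F : fieldType) (p q N a : nat)
    (V : 'M[F]_(p, N)) (U : 'M[F]_(N, q)) :
  (0 < N)%N -> (0 < a)%N -> q = (N * a)%N ->
  (forall i, #|[set j | (V *m U) i j != 0]| = a) ->
  (forall j, exists i, (V *m U) i j != 0) ->
  row_free U /\
  exists i, forall j j', (V *m U) i j != 0 -> (V *m U) i j' != 0 ->
    forall s t, U s j * U t j' = U s j' * U t j.
Proof.
move=> N_gt0 a_gt0 qE; set M := V *m U => rowM colM.
have rM : (\rank M <= N)%N by apply: mulmx_max_rank.
have sMU : (M <= U)%MS by apply: submxMl.
clearbody M; set f := maxrankfun M; set B := rowsub f M.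
have BM : (B :=: M)%MS by apply: eq_maxrowsub.
have BE k j : B k j = M (f k) j by rewrite mxE.
clearbody B.
pose d j := #|[set k | B k j != 0]|.
(* A column vanishing on the row basis [B] would vanish on all of [M]. *)
have d_gt0 j : (0 < d j)%N.
  rewrite lt0n; apply/negP=> /eqP/cards0_eq Bj0.
  have [i /eqP[]] := colM j.
  have /submxP[c rowMi] : (row i M <= B)%MS by rewrite BM row_sub.
  have -> : M i j = row i M 0 j by rewrite mxE.
  rewrite rowMi mxE big1 // => k _.
  have : k \notin [set k | B k j != 0] by rewrite Bj0 inE.
  by rewrite inE negbK => /eqP->; rewrite mulr0.
(* Double counting: each row of [B] is a row of [M], so has [a] nonzero entries. *)
have sum_d : (\sum_j d j = \rank M * a)%N.
  under eq_bigr => j _ do rewrite /d -sum1dep_card big_mkcond /=.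
  rewrite exchange_big /= -[X in (X * a)%N]card_ord -sum_nat_const.
  apply: eq_bigr => k _; rewrite -(rowM (f k)) -sum1dep_card [RHS]big_mkcond /=.
  by apply: eq_bigr => j _; rewrite BE.
have q_le : (q <= \sum_j d j)%N.
  by rewrite -[X in (X <= _)%N]card_ord -sum1_card; apply: leq_sum.
(* These [q] positive integers have sum at most [N * a = q]. *)
have d1 j : d j = 1%N.
  apply/eqP; rewrite eqn_leq d_gt0 andbT leqNgt; apply/negP=> dj.
  have : (q < \sum_j d j)%N.
    rewrite -[X in (X < _)%N]card_ord -sum1_card (bigD1 j) //= [leqRHS](bigD1 j) //=.
    by rewrite -addSn leq_add // leq_sum.
  by rewrite ltnNge sum_d (leq_trans _ (eq_leq (esym qE))) // leq_mul2r rM orbT.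
have rME : \rank M = N.
  by apply/eqP; rewrite eqn_leq rM -(leq_pmul2r a_gt0) -sum_d -qE.
have rU : \rank U = N.
  by apply/eqP; rewrite eqn_leq rank_leq_row -[X in (X <= _)%N]rME mxrankS.
split; first exact/eqP.
have /submxP[c UE] : (U <= B)%MS.
  by rewrite BM -(mxrank_leqif_sup sMU) rME rU.
have k0 : 'I_(\rank M) by rewrite rME; exists 0%N.
exists (f k0) => j j'; rewrite -!BE => Bj Bj' s t.
(* Column [l] of [B] has its only nonzero entry in row [k0], so column [l] of [U = c *m B] is a
   multiple of column [k0] of [c]. *)
have UcB l u : B k0 l != 0 -> U u l = c u k0 * B k0 l.
  move=> Bl; rewrite UE mxE (bigD1 k0) //= big1 ?addr0 // => k kk0.
  have /eqP/cards1P[k1 Ek1] := d1 l.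
  have k1E k' : (B k' l != 0) = (k' == k1) by rewrite -in_set1 -Ek1 inE.
  have := k1E k0; rewrite Bl => /esym/eqP k01.
  have := k1E k; rewrite -k01 (negbTE kk0) => /negbFE/eqP->.
  by rewrite mulr0.
by rewrite !UcB // mulrACA [RHS]mulrACA [B k0 j' * _]mulrC.
Qed.

(** Cosets are ranked among all subsets of [gT]; casting to a field of characteristic 0 keeps the
    labels distinct. *)
Definition coset_label (gT : finGroupType) (H : {group gT}) (x : gT) : rat :=
  (enum_rank (x *: H)%g)%:R.

Lemma coset_label_eq (gT : finGroupType) (H : {group gT}) (x y : gT) :
  (coset_label H x == coset_label H y) = (x \in y *: H)%g.
Proof.
rewrite /coset_label Num.Theory.eqr_nat (inj_eq val_inj) (inj_eq enum_rank_inj).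
exact: sameP eqP lcoset_eqP.
Qed.

Lemma uncovered_coset_structure (gT : finGroupType) (G : {group gT}) (n : nat)
    (H : 'I_n -> {group gT}) (g : 'I_n -> gT) (A : {set gT}) :
  (forall i, g i \in G) ->
  A = (G :\: \bigcup_(i < n) (g i *: H i))%g -> A != set0 ->
  #|G| = (2 ^ n * #|A|)%N ->
  injective H /\ {in A &, forall x y i, x \in (y *: H i)%g}.
Proof.
move=> gG AE /set0Pn[a Aa] GE.
have sAG : A \subset G by rewrite AE subsetDl.
pose e : 'I_#|G| -> gT := enum_val.
have eG j : e j \in G by apply: enum_valP.
have e_surj x : x \in G -> exists j, e j = x.
  by move=> Gx; exists (enum_rank_in Gx x); apply: enum_rankK_in.
pose T := {set 'I_n}.
pose phi i x := coset_label (H i) x.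
pose V := \matrix_(i < #|G|, s < #|T|)
  \prod_k (if k \in enum_val s then 1 else - phi k (e i * g k)%g).
pose U := \matrix_(s < #|T|, j < #|G|) \prod_(k in enum_val s) phi k (e j).
have UE (S : T) j : U (enum_rank S) j = \prod_(k in S) phi k (e j).
  by rewrite mxE enum_rankK.
have VUE i j : (V *m U) i j = \prod_k (phi k (e j) - phi k (e i * g k)%g).
  rewrite mxE bigA_distr [RHS]big_enum_val /=.
  apply: eq_bigr => s _; rewrite !mxE [X in _ * X]big_mkcond -big_split /=.
  by apply: eq_bigr => k _; case: ifP => _; rewrite ?mul1r ?mulr1.
have VU_neq0 i j : ((V *m U) i j != 0) = ((e i)^-1 * e j \in A)%g.
  rewrite VUE AE in_setD groupM ?groupV // andbT.
  have cosetE k : (phi k (e j) == phi k (e i * g k)%g)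
      = ((e i)^-1 * e j \in g k *: H k)%g.
    by rewrite coset_label_eq !mem_lcoset invMg mulgA.
  apply/prodf_neq0/idP => [nz | nc k _].
    apply/bigcupP=> -[k _]; rewrite -cosetE -subr_eq0.
    by apply/negP; apply: nz.
  rewrite subr_eq0 cosetE; apply: contra nc => kC.
  by apply/bigcupP; exists k.
have cardT : #|T| = (2 ^ n)%N.
  by rewrite -cardsT -powersetT card_powerset cardsT card_ord.
have [|||||freeU [i parU]] := @sparse_mulmx _ _ _ _ #|A| V U.
- by rewrite cardT expn_gt0.
- by apply/card_gt0P; exists a.
- by rewrite cardT.
- move=> i; rewrite -[RHS](card_lcoset A (e i)).
  rewrite -(card_imset _ enum_val_inj); apply: eq_card => x.
  apply/imsetP/idP => [[j] | Ax].
    by rewrite inE VU_neq0 -mem_lcoset => ? ->.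
  have [|j jx] := e_surj x.
    move: Ax; rewrite mem_lcoset => /(subsetP sAG).
    by rewrite groupMl ?groupV.
  by exists j => //; rewrite inE VU_neq0 jx -mem_lcoset.
(* This row is chosen so that [(e i)^-1 * e j = a], which is in [A]. *)
- move=> j; have [|i ij] := e_surj (e j * a^-1)%g.
    by rewrite groupM ?groupV ?(subsetP sAG a).
  by exists i; rewrite VU_neq0 ij invMg invgK mulgKV.
split=> [k l Hkl | x y Ax Ay k].
  apply/eqP/negPn/negP => kl.
  have : row (enum_rank [set k]) U = row (enum_rank [set l]) U.
    by apply/rowP=> j; rewrite mxE [RHS]mxE !UE !big_set1 /phi Hkl.
  rewrite !rowE => /(row_free_inj freeU)/matrixP/(_ 0 (enum_rank [set k]))/eqP.
  rewrite !mxE !eqxx /= (inj_eq enum_rank_inj) (inj_eq set1_inj).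
  by rewrite (negbTE kl) oner_eq0.
have [|jx ex] := e_surj (e i * x)%g; first by rewrite groupM ?(subsetP sAG x).
have [|jy ey] := e_surj (e i * y)%g; first by rewrite groupM ?(subsetP sAG y).
have := parU jx jy; rewrite !VU_neq0 ex ey !mulKg => /(_ Ax Ay).
(* The row of [set0] is constantly 1, so parallel columns agree in row [[set k]]. *)
move=> /(_ (enum_rank [set k]) (enum_rank set0)).
rewrite !UE !big_set1 !big_set0 !mulr1 ex ey => /eqP.
by rewrite coset_label_eq !mem_lcoset invMg -mulgA mulKg.
Qed.

Theorem theorem2 (gT : finGroupType) (G : {group gT}) (n : nat) (n_gt0 : (0 < n)%N)
    (H : 'I_n -> {group gT}) (g : 'I_n -> gT)
    (sHG : forall i : 'I_n, H i \subset G) (gG : forall i : 'I_n, g i \in G) :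
  let A : {set gT} := (G :\: \bigcup_(i < n) (g i *: H i))%g in
  let K : {set gT} := (\bigcap_(i < n) H i)%g in
  A != set0 ->
  ((#|A|%:R = #|G|%:R / 2%:R ^+ n :> rat)%R <->
     ((exists2 a : gT, a \in G & A = (a *: K)%g) /\ #|G : K|%g = (2 ^ n)%N)) /\
  ((#|A|%:R = #|G|%:R / 2%:R ^+ n :> rat)%R ->
     forall i j : 'I_n, i != j -> H i <> H j).
Proof.
move=> A K A_n0.
have AGE : (#|A|%:R = #|G|%:R / 2%:R ^+ n :> rat)%R <-> #|G| = (2 ^ n * #|A|)%N.
  have u2 : (2%:R ^+ n : rat)%R \is a GRing.unit.
    by rewrite unitfE expf_neq0.
  split=> [AE | ->].
    apply/eqP; rewrite mulnC -(Num.Theory.eqr_nat rat) natrM natrX AE.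
    by rewrite divrK.
  by rewrite natrM natrX mulrC mulKr.
have sKG : K \subset G.
  (* An empty intersection would be all of [gT]; [n_gt0] supplies an index. *)
  by rewrite /K (bigcap_min (Ordinal n_gt0)).
split; last first.
  move=> /AGE GE i j /eqP ij Hij.
  by have [/(_ i j Hij)] := uncovered_coset_structure gG erefl A_n0 GE.
have LK : (#|K| * #|G : K|)%N = #|G| by apply: (@Lagrange _ G [group of K]).
split=> [/AGE GE | [[a Ga AaK] iK]]; last first.
  by apply/AGE; rewrite AaK card_lcoset -LK iK mulnC.
have [_ AH] := uncovered_coset_structure gG erefl A_n0 GE.
have /set0Pn[a Aa] := A_n0.
have Ga : a \in G by move: Aa; rewrite inE => /andP[].
have AaK : A = (a *: K)%g.
  apply/setP=> x; apply/idP/idP => [Ax | ].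
    by rewrite mem_lcoset; apply/bigcapP=> i _; rewrite -mem_lcoset AH.
  (* Conversely, each [g i *: H i] is a union of left cosets of [K], so one containing [x] would
     contain [a]. *)
  rewrite mem_lcoset => Kx.
  have Gx : x \in G by rewrite -(mulKVg a x) groupM // (subsetP sKG).
  rewrite inE Gx andbT; apply: contraL Aa => /bigcupP[i _ xi].
  rewrite inE Ga andbT negbK; apply/bigcupP; exists i => //.
  move/bigcapP: Kx => /(_ i isT); rewrite -mem_lcoset => xa.
  by rewrite -(lcoset_eqP xi) lcoset_sym.
split; first by exists a.
apply/eqP; rewrite -(@eqn_pmul2l #|K|) ?(cardG_gt0 [group of K]) //.
by rewrite LK GE AaK card_lcoset mulnC.
Qed.
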